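(* Let $f(z) = \sum_{n \in \mathbb{Z}} \frac{1}{(z-n)^2}$ for $z \in \mathbb{C} \setminus \mathbb{Z}$, and let $g = 1/f$ be its reciprocal, regarded as an entire function (with value $0$ at each integer). Let $a_0 = 2 \sum_{n=1}^{\infty} \frac{1}{n^2}$. Then the entire function $g$ satisfies $$g'' + 12 a_0 \, g = 2$$ on $\mathbb{C}$.
   Context: The series defining $f$ converges normally on $\mathbb{C} \setminus \mathbb{Z}$, so $f$ is holomorphic there; it is meromorphic on $\mathbb{C}$ with a double pole at each integer, and it is nowhere zero on $\mathbb{C}\setminus\mathbb{Z}$. Hence $g = 1/f$, defined as $1/f(z)$ for $z \in \mathbb{C}\setminus\mathbb{Z}$ and as $0$ at each integer, is an entire function with a double zero at each integer. The constant $a_0 = 2\sum_{n=1}^\infty n^{-2}$ is the constant term in the Laurent expansion $f(z) = z^{-2} + a_0 + a_1 z^2 + \cdots$ of $f$ about $0$. *)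

(* Defs.v *)
From Stdlib Require Import Reals ZArith ClassicalEpsilon.
From Coquelicot Require Import Coquelicot.

Local Open Scope C_scope.

Definition ZtoC (n : Z) : C := RtoC (IZR n).

Definition is_integer (z : C) : Prop := exists n : Z, z = ZtoC n.

(* Since convergence in C is componentwise, this is the sum of every convergent
   complex series; like [Series], it is an arbitrary value on the others. *)
Definition CSeries (u : nat -> C) : C :=
  (Series (fun k => Re (u k)), Series (fun k => Im (u k))).

(* The indices n = 0, 1, 2, ... and n = -1, -2, ... are summed as two separate
   series, which is the sum over Z whenever that sum converges absolutely. *)
Definition CSeries_Z (u : Z -> C) : C :=
  CSeries (fun k => u (Z.of_nat k)) + CSeries (fun k => u (- Z.of_nat (S k))%Z).

(* Only meaningful when z is not an integer. *)
Definition f (z : C) : C := CSeries_Z (fun n => 1 / (z - ZtoC n) ^ 2).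

Definition g (z : C) : C :=
  if excluded_middle_informative (is_integer z) then 0 else 1 / f z.

Definition a0 : R := (2 * Series (fun k => 1 / INR (S k) ^ 2))%R.

(* Main.v *)
From Stdlib Require Import Reals ZArith Lra Lia ClassicalEpsilon.
From Coquelicot Require Import Coquelicot.
Require Import Defs.

(** The proof identifies [f] with a trigonometric function and then reads the
    differential equation off: [f z = pi^2 / sin^2 (pi z)] away from the
    integers, so that [g z = sin^2 (pi z) / pi^2 = (1 - cos (2 pi z)) / (2 pi^2)]
    everywhere, and [a0 = pi^2 / 3], whence
    [g'' + 12 a0 g = 2 cos (2 pi z) + 2 (1 - cos (2 pi z)) = 2].

    The partial fraction expansion ([f_eq_csc_sq]) is obtained by the Herglotz
    trick.  Both [f] and [csc_sq z = pi^2 / sin^2 (pi z)] have period 1 and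
    satisfy the functional equation [F (z/2) + F ((z-1)/2) = 4 F z]: for [f] it
    splits the sum over Z into even and odd indices ([f_halving]), for [csc_sq]
    it is [1/sin^2 + 1/cos^2 = 4/sin^2] of the doubled angle
    ([csc_sq_halving]).  On the strip [|Re z| <= 1/2] both differ from [1/z^2]
    by a bounded function, so by periodicity their difference [h] is bounded on
    the complement of the integers.  The functional equation turns a bound [M]
    for [|h|] into the bound [2M/4], hence [h = 0] ([halving_fixed_zero]).
    Only boundedness of [h] is used, not its continuity, so neither Liouville's
    theorem nor removable singularities are called upon.

    The same functional equation evaluates [a0].  With the convention
    [1 / 0 = 0] the term of index 0 vanishes at [z = 0], so [f 0 = a0], and the
    splitting into even and odd indices remains valid there:
    [a0 + f (-1/2) = 4 a0], where [f (-1/2) = pi^2].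

    The complex sine and cosine are defined through their real and imaginary
    parts.  Two estimates near the origin, [|sin w - w| <= 6 |w|^3] and
    [|cos w - 1| <= 14 |w|^2], serve twice: they bound [1/sin^2 w - 1/w^2], and
    with the addition formulas they give the complex derivatives. *)

Local Open Scope R_scope.

(** * Estimates for the real trigonometric and hyperbolic functions *)

(** The lower bound is a truncation of the Taylor series; it holds up to 4
    because there the terms after the first one alternate and decrease. *)
Lemma sin_bounds_nonneg x : 0 <= x <= 4 -> x - x ^ 3 / 6 <= sin x <= x.
Proof.
intros [H0 H4]. destruct (pre_sin_bound x 0 H0 H4) as [Hl _].
unfold sin_approx, sin_term in Hl; simpl in Hl.
split; [ lra | ].
destruct H0 as [H0 | <-]; [ left; now apply sin_lt_x | rewrite sin_0; lra ].
Qed.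

Lemma sin_sub_id_le x : Rabs x <= 1 -> Rabs (sin x - x) <= Rabs x ^ 3 / 6.
Proof.
intros Hx. destruct (Rle_dec 0 x) as [H|H].
- rewrite (Rabs_pos_eq x) in * by easy.
  destruct (sin_bounds_nonneg x); [lra|]. apply Rabs_le. lra.
- rewrite (Rabs_left x) in * by lra.
  destruct (sin_bounds_nonneg (- x)); [lra|]. rewrite sin_neg in *.
  apply Rabs_le. lra.
Qed.

Lemma sin_ge_third x : Rabs x <= PI / 2 -> Rabs x / 3 <= Rabs (sin x).
Proof.
assert (HP := PI_4).
assert (Hpos : forall t, 0 <= t <= PI / 2 -> t / 3 <= sin t).
{ intros t Ht. destruct (sin_bounds_nonneg t); [lra|].
  assert (t ^ 2 <= 4) by nra. nra. }
intros Hx. destruct (Rle_dec 0 x) as [H|H].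
- rewrite (Rabs_pos_eq x) in * by easy. specialize (Hpos x).
  rewrite Rabs_pos_eq; lra.
- rewrite (Rabs_left x) in * by lra. specialize (Hpos (- x)).
  rewrite sin_neg in Hpos. rewrite Rabs_left1; lra.
Qed.

Lemma Rabs_sin_le x : Rabs x <= 1 -> Rabs (sin x) <= Rabs x.
Proof.
intros Hx. destruct (Rle_dec 0 x) as [H|H].
- rewrite (Rabs_pos_eq x) in * by easy.
  destruct (sin_bounds_nonneg x); [lra|]. apply Rabs_le. nra.
- rewrite (Rabs_left x) in * by lra.
  destruct (sin_bounds_nonneg (- x)); [lra|]. rewrite sin_neg in *.
  apply Rabs_le. nra.
Qed.

Lemma cos_sub_1_le x : Rabs x <= 1 -> Rabs (cos x - 1) <= Rabs x ^ 2 / 2.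
Proof.
intros Hx. replace (cos x) with (cos (2 * (x / 2))) by (f_equal; field).
rewrite cos_2a_sin.
replace (1 - 2 * sin (x / 2) * sin (x / 2) - 1)
  with (- (2 * (sin (x / 2)) ^ 2)) by ring.
rewrite Rabs_Ropp, Rabs_pos_eq by nra.
assert (E : Rabs (x / 2) = Rabs x / 2)
  by (unfold Rdiv; rewrite Rabs_mult, (Rabs_pos_eq (/ 2)); lra).
assert (H : Rabs (sin (x / 2)) <= Rabs x / 2)
  by (rewrite <- E; apply Rabs_sin_le; lra).
rewrite <- (pow2_abs (sin _)). assert (P := Rabs_pos (sin (x / 2))). nra.
Qed.

Lemma cosh_sq_sub_sinh_sq y : cosh y ^ 2 - sinh y ^ 2 = 1.
Proof.
unfold cosh, sinh. replace 1 with (exp y * exp (- y)); [field|].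
rewrite <- exp_plus, Rplus_opp_r. apply exp_0.
Qed.

Lemma cosh_plus x y : cosh (x + y) = cosh x * cosh y + sinh x * sinh y.
Proof. unfold cosh, sinh. rewrite Ropp_plus_distr, !exp_plus. field. Qed.

Lemma sinh_plus x y : sinh (x + y) = sinh x * cosh y + cosh x * sinh y.
Proof. unfold cosh, sinh. rewrite Ropp_plus_distr, !exp_plus. field. Qed.

Lemma cosh_opp y : cosh (- y) = cosh y.
Proof. unfold cosh. rewrite Ropp_involutive. field. Qed.

Lemma sinh_opp y : sinh (- y) = - sinh y.
Proof. unfold sinh. rewrite Ropp_involutive. field. Qed.

Lemma cosh_ge_1 y : 1 <= cosh y.
Proof.
assert (H := cosh_sq_sub_sinh_sq y).
assert (0 < cosh y) by (unfold cosh; generalize (exp_pos y) (exp_pos (- y)); lra).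
nra.
Qed.

Lemma exp_le x y : x <= y -> exp x <= exp y.
Proof. intros [H | ->]; [left; now apply exp_increasing | lra]. Qed.

Lemma cosh_le_2 y : Rabs y <= 1 -> cosh y <= 2.
Proof.
assert (H : forall t, 0 <= t <= 1 -> cosh t <= 2).
{ intros t Ht. unfold cosh.
  assert (exp t <= exp 1) by (apply exp_le; lra).
  assert (exp (- t) <= exp 0) by (apply exp_le; lra).
  rewrite exp_0 in *. assert (H3 := exp_le_3). lra. }
intros Hy. destruct (Rle_dec 0 y) as [Hp|Hn].
- rewrite Rabs_pos_eq in Hy by easy. apply H; lra.
- rewrite Rabs_left in Hy by lra. rewrite <- cosh_opp. apply H; lra.
Qed.

Lemma sinh_mean_value y : 0 <= y -> exists c, sinh y = y * cosh c /\ 0 <= c <= y.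
Proof.
intros [Hy | <-].
- destruct (MVT_cor2 sinh cosh 0 y Hy) as (c & Hc & Hc').
  { intros c _. apply derivable_pt_lim_sinh. }
  exists c. rewrite sinh_0 in Hc. split; lra.
- exists 0. rewrite sinh_0. split; lra.
Qed.

Lemma Rabs_sinh y : Rabs (sinh y) = sinh (Rabs y).
Proof.
assert (H : forall t, 0 <= t -> Rabs (sinh t) = sinh t).
{ intros t Ht. apply Rabs_pos_eq. destruct (sinh_mean_value t Ht) as (c & -> & _).
  generalize (cosh_ge_1 c); nra. }
destruct (Rle_dec 0 y) as [Hp|Hn].
- rewrite (Rabs_pos_eq y) by easy. now apply H.
- rewrite (Rabs_left y), <- (H (- y)), sinh_opp, Rabs_Ropp by lra. easy.
Qed.

Lemma Rabs_le_sinh y : Rabs y <= Rabs (sinh y).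
Proof.
rewrite Rabs_sinh. assert (Hp := Rabs_pos y).
destruct (sinh_mean_value _ Hp) as (c & -> & _).
generalize (cosh_ge_1 c); nra.
Qed.

Lemma Rabs_sinh_le y : Rabs y <= 1 -> Rabs (sinh y) <= 2 * Rabs y.
Proof.
intros Hy. rewrite Rabs_sinh. assert (Hp := Rabs_pos y).
destruct (sinh_mean_value _ Hp) as (c & -> & Hc).
assert (cosh c <= 2) by (apply cosh_le_2; rewrite Rabs_pos_eq; lra). nra.
Qed.

Lemma cosh_sub_1_le y : Rabs y <= 1 -> Rabs (cosh y - 1) <= 2 * Rabs y ^ 2.
Proof.
intros Hy. assert (E : cosh y = 1 + 2 * sinh (y / 2) ^ 2).
{ replace y with (y / 2 + y / 2) at 1 by field. rewrite cosh_plus.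
  generalize (cosh_sq_sub_sinh_sq (y / 2)). lra. }
rewrite E. replace (1 + 2 * sinh (y / 2) ^ 2 - 1) with (2 * sinh (y / 2) ^ 2) by ring.
rewrite Rabs_pos_eq, <- (pow2_abs (sinh _)) by nra.
assert (E' : Rabs (y / 2) = Rabs y / 2)
  by (unfold Rdiv; rewrite Rabs_mult, (Rabs_pos_eq (/ 2)); lra).
assert (H : Rabs (sinh (y / 2)) <= 2 * (Rabs y / 2))
  by (rewrite <- E'; apply Rabs_sinh_le; lra).
assert (P := Rabs_pos (sinh (y / 2))). nra.
Qed.

Lemma sinh_sub_id_le y : Rabs y <= 1 -> Rabs (sinh y - y) <= 2 * Rabs y ^ 3.
Proof.
assert (H : forall t, 0 <= t <= 1 -> Rabs (sinh t - t) <= 2 * t ^ 3).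
{ intros t Ht. destruct (sinh_mean_value t) as (c & -> & Hc); [lra|].
  assert (Hb : Rabs (cosh c - 1) <= 2 * Rabs c ^ 2)
    by (apply cosh_sub_1_le; rewrite Rabs_pos_eq; lra).
  rewrite Rabs_pos_eq in Hb by (generalize (cosh_ge_1 c); lra).
  rewrite Rabs_pos_eq in Hb by lra.
  rewrite Rabs_pos_eq by (generalize (cosh_ge_1 c); nra).
  assert (c ^ 2 <= t ^ 2) by nra. nra. }
intros Hy. destruct (Rle_dec 0 y) as [Hp|Hn].
- rewrite (Rabs_pos_eq y) in * by easy. apply H; lra.
- rewrite (Rabs_left y) in * by lra. rewrite <- Rabs_Ropp.
  replace (- (sinh y - y)) with (sinh (- y) - (- y)) by (rewrite sinh_opp; ring).
  apply H; lra.
Qed.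

(** * Complex sine and cosine *)

Definition Csin (z : C) : C := (sin (Re z) * cosh (Im z), cos (Re z) * sinh (Im z)).
Definition Ccos (z : C) : C := (cos (Re z) * cosh (Im z), - (sin (Re z) * sinh (Im z))).

Lemma Csin_plus z w : (Csin (z + w) = Csin z * Ccos w + Ccos z * Csin w)%C.
Proof.
destruct z as [a b], w as [c d]. unfold Csin, Ccos; simpl.
rewrite sin_plus, cos_plus, sinh_plus, cosh_plus.
apply injective_projections; simpl; ring.
Qed.

Lemma Ccos_plus z w : (Ccos (z + w) = Ccos z * Ccos w - Csin z * Csin w)%C.
Proof.
destruct z as [a b], w as [c d]. unfold Csin, Ccos; simpl.
rewrite sin_plus, cos_plus, sinh_plus, cosh_plus.
apply injective_projections; simpl; ring.
Qed.

Lemma Csin_sq_plus_Ccos_sq z : (Csin z ^ 2 + Ccos z ^ 2 = 1)%C.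
Proof.
destruct z as [x y]. unfold Csin, Ccos; simpl.
assert (H := sin2_cos2 x). assert (H' := cosh_sq_sub_sinh_sq y).
unfold Rsqr in H.
apply injective_projections; simpl; [|ring].
transitivity ((sin x * sin x + cos x * cos x) * (cosh y ^ 2 - sinh y ^ 2));
  [ring | rewrite H, H'; ring].
Qed.

Lemma Ccos_double z : (Ccos (2 * z) = 1 - 2 * Csin z ^ 2)%C.
Proof.
replace (2 * z)%C with (z + z)%C by ring. rewrite Ccos_plus.
rewrite <- (Csin_sq_plus_Ccos_sq z). ring.
Qed.

Lemma Csin_double z : (Csin (2 * z) = 2 * Csin z * Ccos z)%C.
Proof. replace (2 * z)%C with (z + z)%C by ring. rewrite Csin_plus. ring. Qed.

Lemma Cmod_Csin_sq z : Cmod (Csin z) ^ 2 = sin (Re z) ^ 2 + sinh (Im z) ^ 2.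
Proof.
rewrite Cmod2_alt. destruct z as [x y]; unfold Csin; simpl.
assert (H := sin2_cos2 x). assert (H' := cosh_sq_sub_sinh_sq y). unfold Rsqr in H.
replace (cosh y * (cosh y * 1))  with (1 + sinh y ^ 2) by lra.
transitivity (sin x * sin x * cosh y ^ 2 + (cos x * cos x) * sinh y ^ 2); [ring|].
replace (cos x * cos x) with (1 - sin x * sin x) by lra.
replace (cosh y ^ 2) with (1 + sinh y ^ 2) by lra. ring.
Qed.

(** In [|sin z|^2 = sin^2 x + sinh^2 y] one has [|sin x| >= |x|/3], since the
    strip contains no zero of the sine but 0, and [|sinh y| >= |y|]. *)
Lemma Cmod_Csin_ge z : Rabs (Re z) <= PI / 2 -> Cmod z / 3 <= Cmod (Csin z).
Proof.
intros Hz. apply Rsqr_incr_0_var; [unfold Rsqr | apply Cmod_ge_0].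
assert (E1 := Cmod_Csin_sq z). assert (E2 := Cmod2_alt z).
assert (H1 := sin_ge_third _ Hz). assert (H2 := Rabs_le_sinh (Im z)).
rewrite <- (pow2_abs (sin _)), <- (pow2_abs (sinh _)) in E1.
rewrite <- (pow2_abs (Re z)), <- (pow2_abs (Im z)) in E2.
assert (P1 := Rabs_pos (Re z)). assert (P2 := Rabs_pos (Im z)).
assert ((Rabs (Re z) / 3) ^ 2 <= Rabs (sin (Re z)) ^ 2) by (apply pow_incr; lra).
assert (Rabs (Im z) ^ 2 <= Rabs (sinh (Im z)) ^ 2) by (apply pow_incr; lra).
nra.
Qed.

Lemma Csin_eq_0 z : Csin z = 0 -> exists n : Z, z = RtoC (IZR n * PI).
Proof.
intros H. assert (E := Cmod_Csin_sq z). rewrite H, Cmod_0 in E.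
assert (Hs : sinh (Im z) = 0) by nra. assert (Hx : sin (Re z) = 0) by nra.
destruct (sin_eq_0_0 _ Hx) as [n Hn]. exists n.
assert (Hy := Rabs_le_sinh (Im z)). rewrite Hs, Rabs_R0 in Hy.
destruct z as [x y]; simpl in *. subst x. unfold RtoC. f_equal.
generalize (Rabs_pos y); intros. apply Rabs_eq_0. lra.
Qed.

Lemma Csin_int_PI (n : Z) : Csin (RtoC (IZR n * PI)) = 0.
Proof.
unfold Csin; simpl. rewrite sinh_0, sin_eq_0_1 by (now exists n).
apply injective_projections; simpl; ring.
Qed.

Lemma im_le_Cmod z : Rabs (Im z) <= Cmod z.
Proof.
assert (E := Cmod2_alt z). assert (P := Cmod_ge_0 z).
rewrite <- (pow2_abs (Im z)) in E. assert (P2 := Rabs_pos (Im z)). nra.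
Qed.

Lemma Cmod_le_Re_Im (w : C) : Cmod w <= Rabs (Re w) + Rabs (Im w).
Proof.
assert (E := Cmod2_alt w). assert (P := Cmod_ge_0 w).
rewrite <- (pow2_abs (Re w)), <- (pow2_abs (Im w)) in E.
assert (P1 := Rabs_pos (Re w)). assert (P2 := Rabs_pos (Im w)). nra.
Qed.

(** Real and imaginary parts are estimated separately, after writing
    [sin x cosh y - x = (sin x - x) cosh y + x (cosh y - 1)] and
    [cos x sinh y - y = (cos x - 1) sinh y + (sinh y - y)]. *)
Lemma Csin_sub_id_le z : Cmod z <= 1 -> Cmod (Csin z - z) <= 6 * Cmod z ^ 3.
Proof.
intros Hz. assert (H1 := re_le_Cmod z). assert (H2 := im_le_Cmod z).
eapply Rle_trans; [apply Cmod_le_Re_Im|]. set (r := Cmod z) in *.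
destruct z as [x y]; simpl in *.
assert (S1 := sin_sub_id_le x). assert (S2 := cos_sub_1_le x).
assert (S3 := cosh_le_2 y). assert (S4 := cosh_sub_1_le y).
assert (S5 := Rabs_sinh_le y). assert (S6 := sinh_sub_id_le y).
assert (P1 := Rabs_pos x). assert (P2 := Rabs_pos y).
replace (sin x * cosh y + - x) with ((sin x - x) * cosh y + x * (cosh y - 1)) by ring.
replace (cos x * sinh y + - y) with ((cos x - 1) * sinh y + (sinh y - y)) by ring.
eapply Rle_trans; [apply Rplus_le_compat; apply Rabs_triang|].
rewrite !Rabs_mult.
rewrite (Rabs_pos_eq (cosh y)) by (generalize (cosh_ge_1 y); lra).
assert (Q1 : Rabs x ^ 3 <= r ^ 3) by (apply pow_incr; lra).
assert (Q2 : Rabs y ^ 3 <= r ^ 3) by (apply pow_incr; lra).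
assert (Q3 : Rabs x ^ 2 <= r ^ 2) by (apply pow_incr; lra).
assert (Q4 : Rabs y ^ 2 <= r ^ 2) by (apply pow_incr; lra).
assert (B1 : Rabs (sin x - x) * cosh y <= r ^ 3 / 6 * 2)
  by (apply Rmult_le_compat; [apply Rabs_pos | generalize (cosh_ge_1 y); lra | lra | lra]).
assert (B2 : Rabs x * Rabs (cosh y - 1) <= r * (2 * r ^ 2))
  by (apply Rmult_le_compat; [lra | apply Rabs_pos | lra | lra]).
assert (B3 : Rabs (cos x - 1) * Rabs (sinh y) <= r ^ 2 / 2 * (2 * r))
  by (apply Rmult_le_compat; [apply Rabs_pos | apply Rabs_pos | lra | lra]).
assert (0 <= r ^ 3) by (apply pow_le; lra).
replace (r * (r * (r * 1))) with (r ^ 3) by ring. nra.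
Qed.

(** [cos z - 1 = - 2 sin^2 (z/2)], and [|sin (z/2)| <= 5/4 |z|] by
    [Csin_sub_id_le]. *)
Lemma Ccos_sub_1_le z : Cmod z <= 1 -> Cmod (Ccos z - 1) <= 14 * Cmod z ^ 2.
Proof.
intros Hz. replace z with (2 * (z / 2))%C at 1 by field.
rewrite Ccos_double.
replace (1 - 2 * Csin (z / 2) ^ 2 - 1)%C with (- (2 * Csin (z / 2) ^ 2))%C by ring.
rewrite Cmod_opp, Cmod_mult, Cmod_pow, Cmod_R, Rabs_pos_eq by lra.
assert (E : Cmod (z / 2) = Cmod z / 2).
{ rewrite Cmod_div by (intros H; apply RtoC_inj in H; lra). rewrite Cmod_R, Rabs_pos_eq; lra. }
assert (H := Csin_sub_id_le (z / 2)). rewrite E in H.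
assert (P := Cmod_ge_0 z).
assert (T := Cmod_triangle (Csin (z / 2) - z / 2) (z / 2)).
replace (Csin (z / 2) - z / 2 + z / 2)%C with (Csin (z / 2)) in T by ring.
assert (P' := Cmod_ge_0 (Csin (z / 2))). rewrite E in T.
assert ((Cmod z / 2) ^ 3 <= Cmod z / 8).
{ replace ((Cmod z / 2) ^ 3) with (Cmod z * Cmod z ^ 2 / 8) by field.
  assert (Cmod z ^ 2 <= 1) by nra. nra. }
assert (Cmod (Csin (z / 2)) <= 5 / 4 * Cmod z) by lra.
assert (Cmod (Csin (z / 2)) ^ 2 <= (5 / 4 * Cmod z) ^ 2) by (apply pow_incr; lra).
nra.
Qed.

(** * Real series indexed by Z *)

Definition ex_sumZ (a : Z -> R) : Prop :=
  ex_series (fun k => a (Z.of_nat k)) /\ ex_series (fun k => a (- Z.of_nat (S k))%Z).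

Definition sumZ (a : Z -> R) : R :=
  Series (fun k => a (Z.of_nat k)) + Series (fun k => a (- Z.of_nat (S k))%Z).

Lemma sumZ_ext a b : (forall n, a n = b n) -> sumZ a = sumZ b.
Proof. intros H. unfold sumZ. f_equal; apply Series_ext; intros; apply H. Qed.

Lemma ex_sumZ_ext a b : (forall n, a n = b n) -> ex_sumZ a -> ex_sumZ b.
Proof.
intros H [H1 H2]; split; [revert H1 | revert H2];
  apply ex_series_ext; intros; apply H.
Qed.

Lemma sumZ_scal c a : sumZ (fun n => c * a n) = c * sumZ a.
Proof. unfold sumZ. rewrite !Series_scal_l. ring. Qed.

Lemma ex_sumZ_scal c a : ex_sumZ a -> ex_sumZ (fun n => c * a n).
Proof. intros [H1 H2]; split; now apply @ex_series_scal. Qed.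

Lemma ex_sumZ_shift a : ex_sumZ (fun n => a (n - 1)%Z) <-> ex_sumZ a.
Proof.
unfold ex_sumZ.
rewrite (ex_series_incr_1 (fun k => a (Z.of_nat k - 1)%Z)).
rewrite (ex_series_incr_1 (fun k => a (- Z.of_nat (S k))%Z)).
assert (E1 : ex_series (fun k => a (Z.of_nat (S k) - 1)%Z) <->
             ex_series (fun k => a (Z.of_nat k)))
  by (split; apply ex_series_ext; intros; f_equal; lia).
assert (E2 : ex_series (fun k => a (- Z.of_nat (S k) - 1)%Z) <->
             ex_series (fun k => a (- Z.of_nat (S (S k)))%Z))
  by (split; apply ex_series_ext; intros; f_equal; lia).
tauto.
Qed.

Lemma sumZ_shift a : ex_sumZ a -> sumZ (fun n => a (n - 1)%Z) = sumZ a.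
Proof.
intros Ha. assert (Hs := proj2 (ex_sumZ_shift a) Ha).
unfold sumZ. rewrite (Series_incr_1 _ (proj1 Hs)), (Series_incr_1 _ (proj2 Ha)).
rewrite (Series_ext _ (fun k => a (Z.of_nat k))) by (intros; f_equal; lia).
rewrite (Series_ext (fun n => a (- Z.of_nat (S n) - 1)%Z)
           (fun k => a (- Z.of_nat (S (S k)))%Z)) by (intros; f_equal; lia).
change (Z.of_nat 0 - 1)%Z with (- Z.of_nat 1)%Z. ring.
Qed.

(** A power series in [x] is [E (x^2) + x O (x^2)] with [E] and [O] its even and
    odd parts; this is the case [x = 1]. *)
Lemma is_series_even_odd (a : nat -> R) l1 l2 :
  is_series (fun n => a (2 * n)%nat) l1 -> is_series (fun n => a (2 * n + 1)%nat) l2 ->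
  is_series a (l1 + l2).
Proof.
assert (E : forall (b : nat -> R) l, is_series b l <-> is_pseries b 1 l).
{ intros b l. unfold is_pseries. split; apply is_series_ext; intros n;
  rewrite pow_n_pow, pow1; unfold scal; simpl; unfold mult; simpl; ring. }
rewrite !E. intros H1 H2.
replace (l1 + l2) with (l1 + 1 * l2) by ring.
apply is_pseries_odd_even; replace (1 ^ 2) with 1 by ring; easy.
Qed.

Lemma Series_even_odd (a : nat -> R) :
  ex_series (fun n => a (2 * n)%nat) -> ex_series (fun n => a (2 * n + 1)%nat) ->
  Series a = Series (fun n => a (2 * n)%nat) + Series (fun n => a (2 * n + 1)%nat).
Proof.
intros H1 H2. apply is_series_unique, is_series_even_odd; now apply Series_correct.
Qed.

(** On the negative half, position [k] holds the index [- (k + 1)], so the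
    even positions carry the odd indices and the odd positions the even ones. *)
Lemma sumZ_even_odd a :
  ex_sumZ (fun n => a (2 * n)%Z) -> ex_sumZ (fun n => a (2 * n + 1)%Z) ->
  sumZ a = sumZ (fun n => a (2 * n)%Z) + sumZ (fun n => a (2 * n + 1)%Z).
Proof.
intros [E1 E2] [O1 O2]. unfold sumZ.
assert (I1 : forall k, a (2 * Z.of_nat k)%Z = a (Z.of_nat (2 * k))) by (intros; f_equal; lia).
assert (I2 : forall k, a (2 * Z.of_nat k + 1)%Z = a (Z.of_nat (2 * k + 1)))
  by (intros; f_equal; lia).
assert (I3 : forall k, a (2 * - Z.of_nat (S k))%Z = a (- Z.of_nat (S (2 * k + 1)))%Z)
  by (intros; f_equal; lia).
assert (I4 : forall k, a (2 * - Z.of_nat (S k) + 1)%Z = a (- Z.of_nat (S (2 * k)))%Z)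
  by (intros; f_equal; lia).
rewrite (Series_even_odd (fun k => a (Z.of_nat k))),
  (Series_even_odd (fun k => a (- Z.of_nat (S k))%Z)).
- rewrite (Series_ext _ _ I1), (Series_ext _ _ I2), (Series_ext _ _ I3), (Series_ext _ _ I4). ring.
- exact (ex_series_ext _ _ I4 O2).
- exact (ex_series_ext _ _ I3 E2).
- exact (ex_series_ext _ _ I1 E1).
- exact (ex_series_ext _ _ I2 O1).
Qed.

(** Comparison with the telescoping series of
    [2 / ((k + 1) (k + 2)) = 2 (1 / (k + 1) - 1 / (k + 2))]. *)
Lemma ex_series_inv_sq : ex_series (fun k => 1 / INR (S k) ^ 2).
Proof.
assert (H : is_series (fun k => / INR (S k) - / INR (S (S k))) 1).
{ unfold is_series. change (is_lim_seq (sum_n (fun k => / INR (S k) - / INR (S (S k)))) 1).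
  apply is_lim_seq_ext with (fun n => 1 - / INR (S (S n))).
  - induction n.
    + rewrite sum_O. simpl. field.
    + rewrite sum_Sn, <- IHn. unfold plus; simpl. ring.
  - replace (Finite 1) with (Rbar_minus 1 0) by (simpl; f_equal; ring).
    apply is_lim_seq_minus'; [apply is_lim_seq_const|].
    replace (Finite 0) with (Rbar_inv p_infty) by easy.
    apply is_lim_seq_inv; [|easy].
    exact (proj1 (is_lim_seq_incr_1 (fun n => INR (S n)) _)
             (proj1 (is_lim_seq_incr_1 INR _) is_lim_seq_INR)). }
apply (ex_series_le (V := R_CompleteNormedModule) _ (fun k => 2 * (/ INR (S k) - / INR (S (S k))))).
- intros k. change (Rabs (1 / INR (S k) ^ 2) <= 2 * (/ INR (S k) - / INR (S (S k)))).
  rewrite !S_INR. assert (P := pos_INR k). set (t := INR k) in *.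
  rewrite Rabs_pos_eq by (apply Rle_mult_inv_pos; nra).
  apply Rminus_le_0.
  replace (_ - _) with (t / ((t + 1) ^ 2 * (t + 1 + 1))) by (field; lra).
  apply Rle_mult_inv_pos; [easy | apply Rmult_lt_0_compat; nra].
- apply (ex_series_scal (V := R_NormedModule)). now exists 1.
Qed.

Lemma inv_sq_pos_index k : 4 / IZR (Z.of_nat (S k)) ^ 2 = 4 * (1 / INR (S k) ^ 2).
Proof. rewrite <- INR_IZR_INZ. unfold Rdiv. ring. Qed.

Lemma inv_sq_neg_index k : 4 / IZR (- Z.of_nat (S k)) ^ 2 = 4 * (1 / INR (S k) ^ 2).
Proof.
rewrite <- inv_sq_pos_index, opp_IZR. f_equal. ring.
Qed.

Lemma ex_sumZ_of_le a :
  (forall n : Z, n <> 0%Z -> Rabs (a n) <= 4 / IZR n ^ 2) -> ex_sumZ a.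
Proof.
intros H.
assert (Hb : ex_series (fun k => 4 * (1 / INR (S k) ^ 2)))
  by (apply (ex_series_scal (V := R_NormedModule)), ex_series_inv_sq).
split.
- apply ex_series_incr_1. revert Hb.
  apply (ex_series_le (V := R_CompleteNormedModule)). intros k.
  rewrite <- inv_sq_pos_index. apply H. lia.
- revert Hb. apply (ex_series_le (V := R_CompleteNormedModule)). intros k.
  rewrite <- inv_sq_neg_index. apply H. lia.
Qed.

Lemma sumZ_sub_0_le a :
  (forall n : Z, n <> 0%Z -> Rabs (a n) <= 4 / IZR n ^ 2) ->
  Rabs (sumZ a - a 0%Z) <= 8 * Series (fun k => 1 / INR (S k) ^ 2).
Proof.
intros H. assert (Ha := ex_sumZ_of_le a H).
assert (Hb : ex_series (fun k => 4 * (1 / INR (S k) ^ 2)))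
  by (apply (ex_series_scal (V := R_NormedModule)), ex_series_inv_sq).
assert (T : forall u : nat -> R, (forall k, Rabs (u k) <= 4 * (1 / INR (S k) ^ 2)) ->
  Rabs (Series u) <= 4 * Series (fun k => 1 / INR (S k) ^ 2)).
{ intros u Hu. rewrite <- Series_scal_l. eapply Rle_trans; [apply Series_Rabs|].
  - revert Hb. apply (ex_series_le (V := R_CompleteNormedModule)).
    intros k. change (Rabs (Rabs (u k)) <= 4 * (1 / INR (S k) ^ 2)).
    rewrite Rabs_Rabsolu. apply Hu.
  - apply Series_le; [|easy]. intros k; split; [apply Rabs_pos | apply Hu]. }
unfold sumZ. rewrite (Series_incr_1 _ (proj1 Ha)). change (Z.of_nat 0) with 0%Z.
replace (a 0%Z + _ + _ - a 0%Z) with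
  (Series (fun k => a (Z.of_nat (S k))) + Series (fun k => a (- Z.of_nat (S k))%Z)) by ring.
eapply Rle_trans; [apply Rabs_triang|].
assert (T1 := T (fun k => a (Z.of_nat (S k)))).
assert (T2 := T (fun k => a (- Z.of_nat (S k))%Z)).
assert (D : forall x, 4 * x + 4 * x = 8 * x) by (intros; ring). rewrite <- D.
apply Rplus_le_compat; [apply T1 | apply T2]; intros k.
- rewrite <- inv_sq_pos_index. apply H. lia.
- rewrite <- inv_sq_neg_index. apply H. lia.
Qed.

(** * Periodicity and the halving equation *)

(** Subtract from [z] the integer nearest to its real part. *)
Lemma periodic_from_strip (P : C -> Prop) :
  (forall z, P z <-> P (z + 1)%C) ->
  (forall z, Rabs (Re z) <= 1 / 2 -> P z) -> forall z, P z.
Proof.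
intros Hper Hstrip.
assert (Hnat : forall (n : nat) z, P z <-> P (z + RtoC (INR n))%C).
{ induction n; intros z.
  - simpl. rewrite Cplus_0_r. easy.
  - rewrite S_INR, RtoC_plus, Cplus_assoc, <- Hper. apply IHn. }
assert (HZ : forall (n : Z) z, P z <-> P (z + RtoC (IZR n))%C).
{ intros n z. destruct (Z.le_ge_cases 0 n) as [Hn|Hn].
  - rewrite <- (Z2Nat.id n), <- INR_IZR_INZ by easy. apply Hnat.
  - rewrite (Hnat (Z.to_nat (- n)) (z + RtoC (IZR n))%C).
    rewrite INR_IZR_INZ, Z2Nat.id, opp_IZR, RtoC_opp by lia.
    replace (z + RtoC (IZR n) + - RtoC (IZR n))%C with z by ring. easy. }
intros z. set (m := up (Re z - 1 / 2)).
apply (HZ (- m)%Z), Hstrip.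
destruct (archimed (Re z - 1 / 2)) as [H1 H2]; fold m in H1, H2.
rewrite re_plus, re_RtoC, opp_IZR. apply Rabs_le. lra.
Qed.

(** The functional equation and a bound [M] give [4 |h| <= 2 M]; iterating,
    [|h| <= M / 2^n] for every [n]. *)
Lemma halving_fixed_zero (D : C -> Prop) (h : C -> C) (M : R) :
  (forall z, D z -> D (z / 2)%C /\ D ((z - 1) / 2)%C) ->
  (forall z, D z -> (h (z / 2) + h ((z - 1) / 2) = 4 * h z)%C) ->
  (forall z, D z -> Cmod (h z) <= M) ->
  forall z, D z -> h z = RtoC 0.
Proof.
intros HD Hh HM z Hz.
assert (Hn : forall (n : nat) w, D w -> Cmod (h w) <= M * (/ 2) ^ n).
{ induction n; intros w Hw.
  - simpl. rewrite Rmult_1_r. now apply HM.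
  - destruct (HD w Hw) as [D1 D2].
    assert (E : 4 * Cmod (h w) <= Cmod (h (w / 2)%C) + Cmod (h ((w - 1) / 2)%C)).
    { rewrite <- (Rabs_pos_eq 4), <- Cmod_R, <- Cmod_mult, <- Hh by (easy || lra).
      apply Cmod_triangle. }
    assert (I1 := IHn _ D1). assert (I2 := IHn _ D2). simpl. lra. }
apply Cmod_eq_0, Rle_antisym; [|apply Cmod_ge_0].
change (Rbar_le (Cmod (h z)) 0).
replace (Finite 0) with (Rbar_mult M 0) by (simpl; f_equal; ring).
apply (is_lim_seq_le (fun _ => Cmod (h z)) (fun n => M * (/ 2) ^ n)).
- intros n. now apply Hn.
- apply is_lim_seq_const.
- apply is_lim_seq_scal_l, is_lim_seq_geom. rewrite Rabs_pos_eq; lra.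
Qed.

(** * The series defining f *)

Definition pole_term (z : C) (n : Z) : C := (1 / (z - ZtoC n) ^ 2)%C.

Lemma f_eq_sumZ z : f z = (sumZ (fun n => Re (pole_term z n)), sumZ (fun n => Im (pole_term z n))).
Proof. reflexivity. Qed.

Lemma one_div_0_sq : (1 / 0 ^ 2 = 0)%C.
Proof. apply injective_projections; simpl; unfold Rdiv; ring. Qed.

Lemma pole_term_succ z n : pole_term (z + 1) n = pole_term z (n - 1).
Proof.
unfold pole_term, ZtoC. rewrite minus_IZR, RtoC_minus. f_equal. f_equal. ring.
Qed.

Lemma inv_sq_half w : (1 / (w / 2) ^ 2 = 4 * (1 / w ^ 2))%C.
Proof.
destruct (Ceq_dec w 0) as [-> | Hw].
- replace (0 / 2)%C with (RtoC 0) by (field). rewrite one_div_0_sq. ring.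
- field. easy.
Qed.

(** The convention [1 / 0 = 0] covers the case [z = 2 n], so that the functional
    equation of [f] holds at every point, 0 included. *)
Lemma pole_term_half_even z n : pole_term (z / 2) n = (4 * pole_term z (2 * n))%C.
Proof.
unfold pole_term. rewrite <- inv_sq_half. f_equal. f_equal.
unfold ZtoC. rewrite mult_IZR, RtoC_mult. field.
Qed.

Lemma pole_term_half_odd z n : pole_term ((z - 1) / 2) n = (4 * pole_term z (2 * n + 1))%C.
Proof.
unfold pole_term. rewrite <- inv_sq_half. f_equal. f_equal.
unfold ZtoC. rewrite plus_IZR, mult_IZR, RtoC_plus, RtoC_mult. field.
Qed.

(** On the strip [|z - n| >= |n| - 1/2 >= |n| / 2]. *)
Lemma Cmod_pole_term_le z n : Rabs (Re z) <= 1 / 2 -> n <> 0%Z ->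
  Cmod (pole_term z n) <= 4 / IZR n ^ 2.
Proof.
intros Hz Hn.
assert (Hn1 : 1 <= Rabs (IZR n)).
{ rewrite <- abs_IZR. apply (IZR_le 1). lia. }
assert (H : Rabs (IZR n) / 2 <= Cmod (z - ZtoC n)).
{ eapply Rle_trans; [|apply re_le_Cmod].
  unfold Cminus, ZtoC. rewrite <- RtoC_opp, re_plus, re_RtoC.
  assert (T := Rabs_triang_inv (IZR n) (Re z)).
  rewrite Rabs_minus_sym in T. unfold Rminus in T. lra. }
assert (Hnz : (z - ZtoC n)%C <> 0).
{ intros E. rewrite E, Cmod_0 in H. lra. }
unfold pole_term. rewrite Cmod_div, Cmod_pow by now apply Cpow_nz.
rewrite Cmod_1, <- (pow2_abs (IZR n)).
replace (4 / Rabs (IZR n) ^ 2) with (1 / (Rabs (IZR n) / 2) ^ 2) by (field; lra).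
apply Rmult_le_compat_l; [lra|]. apply Rinv_le_contravar; [nra|].
apply pow_incr; lra.
Qed.

Lemma Re_pole_term_le z n : Rabs (Re z) <= 1 / 2 -> n <> 0%Z ->
  Rabs (Re (pole_term z n)) <= 4 / IZR n ^ 2.
Proof. intros. eapply Rle_trans; [apply re_le_Cmod | now apply Cmod_pole_term_le]. Qed.

Lemma Im_pole_term_le z n : Rabs (Re z) <= 1 / 2 -> n <> 0%Z ->
  Rabs (Im (pole_term z n)) <= 4 / IZR n ^ 2.
Proof. intros. eapply Rle_trans; [apply im_le_Cmod | now apply Cmod_pole_term_le]. Qed.

Lemma pole_term_summable z :
  ex_sumZ (fun n => Re (pole_term z n)) /\ ex_sumZ (fun n => Im (pole_term z n)).
Proof.
revert z. apply periodic_from_strip; intros z.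
- rewrite <- (ex_sumZ_shift (fun n => Re (pole_term z n))),
    <- (ex_sumZ_shift (fun n => Im (pole_term z n))).
  split; intros [H1 H2]; (split;
    [eapply ex_sumZ_ext; [|exact H1] | eapply ex_sumZ_ext; [|exact H2]]);
    intros n; cbv beta; now rewrite pole_term_succ.
- intros Hz. split; apply ex_sumZ_of_le; intros n Hn;
    [now apply Re_pole_term_le | now apply Im_pole_term_le].
Qed.

Lemma f_periodic z : f (z + 1)%C = f z.
Proof.
destruct (pole_term_summable z) as [H1 H2]. rewrite !f_eq_sumZ.
rewrite <- (sumZ_shift _ H1), <- (sumZ_shift _ H2).
f_equal; apply sumZ_ext; intros n; now rewrite pole_term_succ.
Qed.

(** The even-indexed terms at [z] are those at [z/2] up to the factor 4, the
    odd-indexed ones those at [(z-1)/2]. *)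
Lemma f_halving z : (f (z / 2) + f ((z - 1) / 2) = 4 * f z)%C.
Proof.
(* [part] is the real or the imaginary part. *)
assert (L : forall part : C -> R, (forall w, part (4 * w)%C = 4 * part w) ->
  (forall w, ex_sumZ (fun n => part (pole_term w n))) ->
  sumZ (fun n => part (pole_term (z / 2) n)) + sumZ (fun n => part (pole_term ((z - 1) / 2) n))
  = 4 * sumZ (fun n => part (pole_term z n))).
{ intros part Hlin Hex.
  assert (E1 : forall n, part (pole_term (z / 2) n) = 4 * part (pole_term z (2 * n)))
    by (intros; now rewrite pole_term_half_even).
  assert (E2 : forall n, part (pole_term ((z - 1) / 2) n) = 4 * part (pole_term z (2 * n + 1)))
    by (intros; now rewrite pole_term_half_odd).
  rewrite (sumZ_ext _ _ E1), (sumZ_ext _ _ E2), !sumZ_scal,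
    (sumZ_even_odd (fun n => part (pole_term z n))).
  - ring.
  - eapply ex_sumZ_ext; [|apply (ex_sumZ_scal (/ 4)), (Hex (z / 2)%C)].
    intros n; cbv beta; rewrite E1; field.
  - eapply ex_sumZ_ext; [|apply (ex_sumZ_scal (/ 4)), (Hex ((z - 1) / 2)%C)].
    intros n; cbv beta; rewrite E2; field. }
rewrite !f_eq_sumZ. apply injective_projections.
- transitivity (4 * sumZ (fun n => Re (pole_term z n))); [|simpl; ring].
  apply (L Re); [intros; apply re_scal_l | intros; apply pole_term_summable].
- transitivity (4 * sumZ (fun n => Im (pole_term z n))); [|simpl; ring].
  apply (L Im); [intros; apply im_scal_l | intros; apply pole_term_summable].
Qed.

(** At [z = 0] the term of index 0 is [1 / 0 = 0]. *)
Lemma f_0 : f 0 = RtoC a0.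
Proof.
assert (E : forall n, pole_term 0 n = RtoC (1 / IZR n ^ 2) \/ n = 0%Z).
{ intros n. destruct (Z.eq_dec n 0) as [->|Hn]; [now right|left].
  apply not_0_IZR in Hn. unfold pole_term, ZtoC.
  rewrite RtoC_div, RtoC_pow by (now apply pow_nonzero).
  field. intros H. apply RtoC_inj in H. easy. }
assert (E0 : pole_term 0 0 = 0).
{ unfold pole_term, ZtoC, Cminus. rewrite Cplus_opp_r. apply one_div_0_sq. }
(* Written as a multiple by 0, so that [sumZ_scal] sums it. *)
assert (Him : forall n, Im (pole_term 0 n) = 0 * Im (pole_term 0 n)).
{ intros n. destruct (E n) as [-> | ->]; [|rewrite E0]; simpl; ring. }
rewrite f_eq_sumZ. change (RtoC a0) with (a0, 0). f_equal.
- destruct (pole_term_summable 0) as [[H1 _] _]. unfold sumZ.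
  rewrite (Series_incr_1 _ H1). change (Z.of_nat 0) with 0%Z. rewrite E0, re_RtoC.
  unfold a0.
  assert (S1 : forall k, Re (pole_term 0 (Z.of_nat (S k))) = 1 / INR (S k) ^ 2).
  { intros k. destruct (E (Z.of_nat (S k))) as [-> | H]; [|lia].
    now rewrite re_RtoC, <- INR_IZR_INZ. }
  assert (S2 : forall k, Re (pole_term 0 (- Z.of_nat (S k))) = 1 / INR (S k) ^ 2).
  { intros k. destruct (E (- Z.of_nat (S k))%Z) as [-> | H]; [|lia].
    rewrite re_RtoC, opp_IZR, <- INR_IZR_INZ. f_equal. ring. }
  rewrite (Series_ext _ _ S1), (Series_ext _ _ S2). ring.
- rewrite (sumZ_ext _ _ Him), sumZ_scal. ring.
Qed.

(** [1 / z^2] is the term of index 0; the others are at most [4 / n^2] in modulus. *)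
Lemma f_sub_polar_bounded : exists M, forall z, Rabs (Re z) <= 1 / 2 ->
  Cmod (f z - 1 / z ^ 2) <= M.
Proof.
set (B := 8 * Series (fun k => 1 / INR (S k) ^ 2)). exists (B + B). intros z Hz.
assert (E : (1 / z ^ 2)%C = pole_term z 0).
{ unfold pole_term, ZtoC. now replace (z - 0)%C with z by ring. }
rewrite E, f_eq_sumZ.
eapply Rle_trans; [apply Cmod_le_Re_Im|]. apply Rplus_le_compat.
- apply (sumZ_sub_0_le (fun n => Re (pole_term z n))). intros; now apply Re_pole_term_le.
- apply (sumZ_sub_0_le (fun n => Im (pole_term z n))). intros; now apply Im_pole_term_le.
Qed.

(** * The squared cosecant and the partial fraction expansion *)

Definition csc_sq (z : C) : C := (RtoC (PI ^ 2) / Csin (PI * z) ^ 2)%C.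

Lemma PI_C_neq_0 : RtoC PI <> 0.
Proof. intros H. apply RtoC_inj in H. generalize PI_RGT_0. lra. Qed.

Lemma Csin_PI_neq_0 z : ~ is_integer z -> Csin (PI * z) <> 0.
Proof.
intros Hz H. destruct (Csin_eq_0 _ H) as [n Hn]. apply Hz. exists n.
rewrite RtoC_mult, Cmult_comm in Hn. unfold ZtoC.
transitivity (PI * z / PI)%C; [|rewrite <- (Cmult_comm z), Hn]; field; apply PI_C_neq_0.
Qed.

Lemma Csin_minus_PI_half z : Csin (z - PI / 2) = (- Ccos z)%C.
Proof.
replace (z - PI / 2)%C with (z + RtoC (- (PI / 2)))%C.
2: { rewrite RtoC_opp, RtoC_div by lra. easy. }
rewrite Csin_plus. unfold Csin, Ccos. rewrite !re_RtoC, !im_RtoC, cosh_0, sinh_0,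
  sin_neg, cos_neg, sin_PI2, cos_PI2.
apply injective_projections; simpl; ring.
Qed.

Lemma csc_sq_periodic z : csc_sq (z + 1)%C = csc_sq z.
Proof.
unfold csc_sq. replace (PI * (z + 1))%C with (PI * z + RtoC PI)%C by ring.
assert (E : Csin (PI * z + RtoC PI) = (- Csin (PI * z))%C).
{ rewrite Csin_plus. unfold Csin, Ccos. rewrite !re_RtoC, !im_RtoC, cosh_0, sinh_0, sin_PI, cos_PI.
  apply injective_projections; simpl; ring. }
rewrite E. f_equal. ring.
Qed.

Lemma is_integer_half z : is_integer (z / 2)%C -> is_integer z.
Proof.
intros [n Hn]. exists (2 * n)%Z. unfold ZtoC in *. rewrite mult_IZR, RtoC_mult, <- Hn.
field.
Qed.

Lemma is_integer_half_pred z : is_integer ((z - 1) / 2)%C -> is_integer z.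
Proof.
intros [n Hn]. exists (2 * n + 1)%Z. unfold ZtoC in *.
rewrite plus_IZR, mult_IZR, RtoC_plus, RtoC_mult, <- Hn. field.
Qed.

Lemma csc_sq_halving z : ~ is_integer z ->
  (csc_sq (z / 2) + csc_sq ((z - 1) / 2) = 4 * csc_sq z)%C.
Proof.
intros Hz. unfold csc_sq.
assert (Hs := Csin_PI_neq_0 z Hz).
replace (PI * z)%C with (2 * (PI * (z / 2)))%C in * by field.
replace (PI * ((z - 1) / 2))%C with (PI * (z / 2) - PI / 2)%C by field.
rewrite Csin_minus_PI_half. rewrite Csin_double in *.
set (w := (PI * (z / 2))%C) in *.
assert (H := Csin_sq_plus_Ccos_sq w).
assert (Csin w <> 0) by (intros E; apply Hs; rewrite E; ring).
assert (Ccos w <> 0) by (intros E; apply Hs; rewrite E; ring).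
transitivity (RtoC (PI ^ 2) * (Csin w ^ 2 + Ccos w ^ 2) / (Csin w ^ 2 * Ccos w ^ 2))%C.
- field. easy.
- rewrite H. field. easy.
Qed.

(** For [|w| <= 1] the difference is [- (sin w - w) (sin w + w) / (w^2 sin^2 w)],
    with numerator at most [6 |w|^3 * 8 |w|] and denominator at least
    [|w|^4 / 9], which gives [432 = 6 * 8 * 9].  For [|w| > 1] both terms are
    bounded, by [Cmod_Csin_ge]. *)
Lemma inv_Csin_sq_sub_polar_le (w : C) : w <> 0 -> Rabs (Re w) <= PI / 2 ->
  Cmod (1 / Csin w ^ 2 - 1 / w ^ 2) <= 432.
Proof.
intros Hw Hre. assert (Hr := proj1 (Cmod_gt_0 w) Hw).
assert (Hs := Cmod_Csin_ge w Hre).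
assert (Hs0 : Csin w <> 0). { intros E. rewrite E, Cmod_0 in Hs. lra. }
set (r := Cmod w) in *. set (s := Cmod (Csin w)) in *.
destruct (Rle_dec r 1) as [Hr1 | Hr1].
- replace (1 / Csin w ^ 2 - 1 / w ^ 2)%C
    with (- ((Csin w - w) * ((Csin w - w) + 2 * w)) / (Csin w ^ 2 * w ^ 2))%C by (field; easy).
  assert (H3 := Csin_sub_id_le w Hr1). fold r in H3.
  rewrite Cmod_div, Cmod_opp, !Cmod_mult, !Cmod_pow
    by (apply Cmult_neq_0; now apply Cpow_nz).
  fold r s.
  assert (H4 : Cmod (Csin w - w + 2 * w) <= 8 * r).
  { eapply Rle_trans; [apply Cmod_triangle|]. rewrite Cmod_mult, Cmod_R, Rabs_pos_eq by lra.
    fold r. assert (r ^ 3 <= r) by (assert (r ^ 2 <= 1) by nra; nra). lra. }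
  assert (H5 : Cmod (Csin w - w) * Cmod (Csin w - w + 2 * w) <= 6 * r ^ 3 * (8 * r))
    by (apply Rmult_le_compat; try apply Cmod_ge_0; easy).
  assert (H6 : (r / 3) ^ 2 <= s ^ 2) by (apply pow_incr; lra).
  assert (0 < r ^ 2) by nra.
  apply Rle_div_l; [apply Rmult_lt_0_compat; nra|]. nra.
- eapply Rle_trans; [apply Cmod_triangle|].
  rewrite Cmod_opp, !Cmod_div, !Cmod_pow, Cmod_1 by now apply Cpow_nz.
  fold r s.
  assert (1 / s ^ 2 <= 9) by (apply Rle_div_l; nra).
  assert (1 / r ^ 2 <= 1) by (apply Rle_div_l; nra).
  lra.
Qed.

Lemma csc_sq_sub_polar_bounded : exists M, forall z : C, z <> 0 -> Rabs (Re z) <= 1 / 2 ->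
  Cmod (csc_sq z - 1 / z ^ 2) <= M.
Proof.
exists (PI ^ 2 * 432). intros z Hz Hre.
assert (HP := PI_RGT_0). assert (HP' := PI_C_neq_0).
assert (HpR : Rabs (Re (PI * z)) <= PI / 2).
{ rewrite re_scal_l, Rabs_mult, Rabs_pos_eq by lra. nra. }
assert (Hpz : (PI * z)%C <> 0) by now apply Cmult_neq_0.
assert (Hs0 : Csin (PI * z) <> 0).
{ intros E. assert (Hs := Cmod_Csin_ge _ HpR). rewrite E, Cmod_0 in Hs.
  assert (Hr := proj1 (Cmod_gt_0 _) Hpz). lra. }
unfold csc_sq. rewrite RtoC_pow.
replace (PI ^ 2 / Csin (PI * z) ^ 2 - 1 / z ^ 2)%C with
  (PI ^ 2 * (1 / Csin (PI * z) ^ 2 - 1 / (PI * z) ^ 2))%C by (field; easy).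
rewrite Cmod_mult, Cmod_pow, Cmod_R, (Rabs_pos_eq PI) by lra.
apply Rmult_le_compat_l; [nra|]. now apply inv_Csin_sq_sub_polar_le.
Qed.

(** The difference satisfies the functional equation and is bounded: on the strip
    the two poles at 0 cancel, and elsewhere by periodicity. *)
Lemma f_eq_csc_sq z : ~ is_integer z -> f z = csc_sq z.
Proof.
destruct f_sub_polar_bounded as [M1 HM1].
destruct csc_sq_sub_polar_bounded as [M2 HM2].
assert (HM : forall w, ~ is_integer w -> Cmod (f w - csc_sq w) <= M1 + M2).
{ apply (periodic_from_strip (fun w => ~ is_integer w -> Cmod (f w - csc_sq w) <= M1 + M2)).
  - intros w. rewrite f_periodic, csc_sq_periodic.
    assert (is_integer w <-> is_integer (w + 1)%C); [|tauto].
    split; intros [n Hn].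
    + exists (n + 1)%Z. unfold ZtoC in *. now rewrite Hn, plus_IZR, RtoC_plus.
    + exists (n - 1)%Z. unfold ZtoC in *. rewrite minus_IZR, RtoC_minus, <- Hn. ring.
  - intros w Hre Hw.
    assert (Hw0 : w <> 0) by (intros ->; apply Hw; now exists 0%Z).
    replace (f w - csc_sq w)%C with ((f w - 1 / w ^ 2) + - (csc_sq w - 1 / w ^ 2))%C by ring.
    eapply Rle_trans; [apply Cmod_triangle|]. rewrite Cmod_opp.
    apply Rplus_le_compat; [now apply HM1 | now apply HM2]. }
intros Hz.
assert (H : (f z - csc_sq z)%C = 0).
{ refine (halving_fixed_zero (fun w => ~ is_integer w) (fun w => (f w - csc_sq w)%C)
            (M1 + M2) _ _ HM z Hz).
  - intros w Hw. split; intros H; apply Hw.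
    + now apply is_integer_half.
    + now apply is_integer_half_pred.
  - intros w Hw.
    transitivity ((f (w / 2) + f ((w - 1) / 2)) - (csc_sq (w / 2) + csc_sq ((w - 1) / 2)))%C;
      [ring|]. rewrite f_halving, csc_sq_halving by easy. ring. }
replace (f z) with (f z - csc_sq z + csc_sq z)%C by ring. rewrite H. ring.
Qed.

(** The functional equation of [f] at 0 reads [a0 + f (-1/2) = 4 a0], and
    [f (-1/2) = pi^2 / sin^2 (- pi/2) = pi^2]. *)
Lemma a0_eq : a0 = PI ^ 2 / 3.
Proof.
assert (H := f_halving 0).
replace (0 / 2)%C with (RtoC 0) in H by field.
set (w := ((0 - 1) / 2)%C) in H.
assert (Hw : ~ is_integer w).
{ assert (Ew : w = RtoC (-1 / 2))
    by (apply injective_projections; simpl; field).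
  intros [n Hn]. rewrite Ew in Hn. apply RtoC_inj in Hn.
  assert (E : IZR (2 * n) = IZR (-1)) by (rewrite mult_IZR; lra).
  apply eq_IZR in E. lia. }
assert (E : Csin (PI * w) = RtoC (-1)).
{ unfold w. replace (PI * ((0 - 1) / 2))%C with (0 - PI / 2)%C by field.
  rewrite Csin_minus_PI_half. unfold Ccos. simpl. rewrite cos_0, sin_0, cosh_0.
  apply injective_projections; simpl; ring. }
rewrite (f_eq_csc_sq w Hw), f_0 in H. unfold csc_sq in H. rewrite E in H.
apply (f_equal Re) in H.
replace (RtoC (PI ^ 2)%R / RtoC (-1) ^ 2)%C with (RtoC (PI ^ 2)) in H.
2: { apply injective_projections; simpl; field. }
rewrite re_plus, re_scal_l, !re_RtoC in H. lra.
Qed.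

(** * Complex derivatives and the differential equation *)

Lemma is_derive_of_quadratic_error (F : C -> C) (z l : C) (K : R) :
  (forall h, Cmod h <= 1 -> Cmod (F (z + h)%C - F z - h * l) <= K * Cmod h ^ 2) ->
  is_derive (K := C_AbsRing) (V := C_NormedModule) F z l.
Proof.
intros H. split; [apply is_linear_scal_l|].
intros x Hx. apply (is_filter_lim_locally_unique (V := AbsRing_NormedModule C_AbsRing)) in Hx.
subst x.
intros eps.
assert (HK : 0 < Rmin 1 (eps / (Rabs K + 1))).
{ apply Rmin_pos; [lra|]. apply Rdiv_lt_0_compat; [apply eps | generalize (Rabs_pos K); lra]. }
exists (mkposreal _ HK). intros y Hy.
change (Cmod (y - z) < Rmin 1 (eps / (Rabs K + 1))) in Hy.
change (Cmod (F y - F z - (y - z) * l) <= eps * Cmod (y - z)).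
set (h := (y - z)%C) in *. replace y with (z + h)%C by (unfold h; ring).
assert (P := Cmod_ge_0 h).
eapply Rle_trans; [apply H|].
- eapply Rle_trans; [left; apply Hy | apply Rmin_l].
- assert (Hm : Cmod h <= eps / (Rabs K + 1))
    by (eapply Rle_trans; [left; apply Hy | apply Rmin_r]).
  apply Rle_div_r in Hm; [|generalize (Rabs_pos K); lra].
  assert (K <= Rabs K) by apply Rle_abs. nra.
Qed.

(** By the expansions [Ccos h = 1 + O (h^2)] and [Csin h = h + O (h^3)], the
    addition formula is a first-order expansion of [F] at [z]. *)
Lemma is_derive_of_addition (F G : C -> C) z :
  (forall h, F (z + h)%C = (F z * Ccos h + G z * Csin h)%C) ->
  is_derive (K := C_AbsRing) (V := C_NormedModule) F z (G z).
Proof.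
intros H. apply is_derive_of_quadratic_error with (14 * Cmod (F z) + 6 * Cmod (G z)).
intros h Hh. rewrite H.
replace (F z * Ccos h + G z * Csin h - F z - h * G z)%C
  with (F z * (Ccos h - 1) + G z * (Csin h - h))%C by ring.
eapply Rle_trans; [apply Cmod_triangle|]. rewrite !Cmod_mult.
assert (H1 := Ccos_sub_1_le h Hh). assert (H2 := Csin_sub_id_le h Hh).
assert (P := Cmod_ge_0 h). assert (PF := Cmod_ge_0 (F z)). assert (PG := Cmod_ge_0 (G z)).
assert (Cmod h ^ 3 <= Cmod h ^ 2) by nra.
nra.
Qed.

Lemma is_derive_Csin z : is_derive (K := C_AbsRing) (V := C_NormedModule) Csin z (Ccos z).
Proof. apply is_derive_of_addition. intros h. apply Csin_plus. Qed.

Lemma is_derive_Ccos z :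
  is_derive (K := C_AbsRing) (V := C_NormedModule) Ccos z (- Csin z)%C.
Proof.
apply (is_derive_of_addition Ccos (fun w => - Csin w)%C).
intros h. rewrite Ccos_plus. ring.
Qed.

(** [sin^2 (pi z) / pi^2], linearised: a form that is affine in a single cosine
    and vanishes at the integers as [g] does. *)
Lemma g_eq z : g z = ((1 - Ccos (2 * PI * z)) / (2 * PI ^ 2))%C.
Proof.
assert (HP := PI_C_neq_0).
replace (2 * PI * z)%C with (2 * (PI * z))%C by ring. rewrite Ccos_double.
unfold g. destruct (excluded_middle_informative (is_integer z)) as [[n ->] | Hz].
- unfold ZtoC. rewrite <- RtoC_mult, Rmult_comm, Csin_int_PI. field. easy.
- rewrite f_eq_csc_sq by easy. unfold csc_sq. rewrite RtoC_pow.
  assert (Hs := Csin_PI_neq_0 z Hz). field. easy.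
Qed.

(** The derivative of the inner function refers to the norm of the scalars
    [C_AbsRing], that of the outer one to [C_NormedModule]; the two structures on
    the complex numbers are not convertible, hence the explicit annotations. *)
Lemma is_derive_affine_comp (F : C -> C) (F' a b c z : C) :
  is_derive (K := C_AbsRing) (V := C_NormedModule) F (c * z)%C F' ->
  is_derive (K := C_AbsRing) (V := C_NormedModule)
    (fun w => a + b * F (c * w))%C z (b * (c * F'))%C.
Proof.
intros H.
assert (Houter : is_derive (K := C_AbsRing) (V := C_NormedModule)
                   (fun w => a + b * F w)%C (c * z)%C (b * F')%C).
{ replace (b * F')%C with (plus (zero : C_NormedModule) (b * F' : C)%C)
    by (apply Cplus_0_l).
  apply (is_derive_plus (K := C_AbsRing) (V := C_NormedModule)
           (fun _ => a) (fun w => (b * F w)%C)).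
  - apply is_derive_const.
  - eapply filterdiff_ext_lin;
      [apply (filterdiff_scal_r_fct (K := C_AbsRing)
        (U := AbsRing_NormedModule C_AbsRing) (V := C_NormedModule)
        b F (fun y : C => (y * F')%C) Cmult_comm), H|].
    intros y. change (b * (y * F') = y * (b * F'))%C. ring. }
assert (Hinner : is_derive (K := C_AbsRing) (V := AbsRing_NormedModule C_AbsRing)
                   (fun w => c * w)%C z c).
{ assert (D := is_derive_scal_l (K := C_AbsRing) (V := AbsRing_NormedModule C_AbsRing)
                 (fun w => w) z one c (is_derive_id z)).
  rewrite scal_one in D. revert D. apply is_derive_ext. intros t. apply Cmult_comm. }
replace (b * (c * F'))%C with (scal (c : C_AbsRing) (b * F' : C_NormedModule)%C)
  by (change (c * (b * F') = b * (c * F'))%C; ring).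
exact (is_derive_comp (K := C_AbsRing) (V := C_NormedModule) _ _ _ _ _ Houter Hinner).
Qed.

(* Taking [C_AbsRing] as the ring of scalars makes
   [is_derive] the complex derivative. *)
Theorem theorem5 :
  exists g' g'' : C -> C,
    (forall z : C, is_derive (K := C_AbsRing) (V := C_NormedModule) g z (g' z)) /\
    (forall z : C, is_derive (K := C_AbsRing) (V := C_NormedModule) g' z (g'' z)) /\
    (forall z : C, (g'' z + RtoC 12 * RtoC a0 * g z)%C = RtoC 2).
Proof.
assert (HP := PI_C_neq_0).
(* The summand 0 gives the derivative of [g] the shape [a + b * F (c * z)] that
   [is_derive_affine_comp] differentiates. *)
exists (fun z => 0 + / PI * Csin (2 * PI * z))%C, (fun z => 2 * Ccos (2 * PI * z))%C.
split; [|split]; intros z.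
- apply is_derive_ext with (fun w => 1 / (2 * PI ^ 2) + - (1 / (2 * PI ^ 2)) * Ccos (2 * PI * w))%C.
  + intros t. rewrite g_eq. match goal with |- ?x = ?y => change (@eq C x y) end. field. easy.
  + replace (0 + / PI * Csin (2 * PI * z))%C
      with (- (1 / (2 * PI ^ 2)) * (2 * PI * - Csin (2 * PI * z)))%C by (field; easy).
    apply is_derive_affine_comp, is_derive_Ccos.
- replace (2 * Ccos (2 * PI * z))%C with (/ PI * (2 * PI * Ccos (2 * PI * z)))%C by (field; easy).
  apply is_derive_affine_comp, is_derive_Csin.
- rewrite g_eq, a0_eq. rewrite RtoC_div, RtoC_pow by lra. field. easy.
Qed.
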